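(* Let $m\ge 2$ and $N\ge m$ be integers and let $p$ be a real number with $0<Np<1$. Let $(X_t)_{t\ge 0}$ be the time-homogeneous Markov chain on $\{1,\dots,m\}$ with $$\mathcal P\{X_{t+1}=k\mid X_t=k+1\}=kp,\qquad \mathcal P\{X_{t+1}=k+1\mid X_t=k+1\}=1-kp,\qquad k=0,1,\dots,m-1$$ (so state $1$ is absorbing). For $i\in\{1,\dots,m\}$ let $T_i=\inf\{t\ge 0: X_t=1\}$ for the chain started at $X_0=i$, and let $M_i=\mathbb E[T_i]$. Then for all $i\in\{1,\dots,m\}$, $$M_i=\frac1p\sum_{n=1}^{i-1}\frac1n ,$$ and in particular, for the worst initial case $X_0=m$, $$M_m=\frac1p\sum_{n=1}^{m-1}\frac1n\le\frac{1+\ln(m-1)}{p}.$$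
   Context: The chain models the number of nodes in a given node's similar view whose utility differs from that node's own utility, in a network of $N$ nodes in which each node is sampled with constant probability $p$ at each time step; $m$ is the largest number of nodes sharing a common utility value. An empty sum is $0$. *)

(* Defs.v *)
From HB Require Import structures.
From mathcomp Require Import all_boot all_order all_algebra.
From mathcomp Require Import all_classical all_reals all_analysis.

Set Implicit Arguments.
Unset Strict Implicit.
Unset Printing Implicit Defensive.

Import Order.TTheory GRing.Theory Num.Theory.

Local Open Scope classical_set_scope.
Local Open Scope ring_scope.

(* P(A | B); the value is meaningful only when 0 < P B. *)
Definition cond_prob d (T : measurableType d) (R : realType)
    (P : probability T R) (A B : set T) : R :=
  fine (P (A `&` B)) / fine (P B).

Definition history d (T : measurableType d) (R : realType)
    (P : probability T R) (X : nat -> {RV P >-> nat}) (t : nat)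
    (x : nat -> nat) : set T :=
  [set w | forall s, (s <= t)%N -> X s w = x s].

(* X is a time-homogeneous Markov chain on the state space S with one-step
   transition probabilities Q. The history includes the present state x t, so
   this expresses both the Markov property and the values of
   P(X_{t+1} = b | X_t = a). *)
Definition markov_chain d (T : measurableType d) (R : realType)
    (P : probability T R) (S : set nat) (Q : nat -> nat -> R)
    (X : nat -> {RV P >-> nat}) : Prop :=
  (forall t w, S (X t w)) /\
  (forall (t : nat) (x : nat -> nat) (b : nat),
     S b -> (0 < P (history X t x))%E ->
     cond_prob P [set w | X t.+1 w = b] (history X t x) = Q (x t) b).

(* Only states a >= 1 matter: from a = k + 1 the chain moves to k with
   probability k p and stays put with probability 1 - k p. *)
Definition descent_trans (R : realType) (p : R) (a b : nat) : R :=
  if a == b.+1 then b%:R * p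
  else if a == b then 1 - a.-1%:R * p
  else 0.

(* inf {t >= 0 | X_t = s}, equal to +oo when s is never visited. *)
Definition hitting_time d (T : measurableType d) (R : realType)
    (P : probability T R) (X : nat -> {RV P >-> nat}) (s : nat) (w : T)
    : \bar R :=
  ereal_inf [set (t%:R%:E : \bar R) | t in [set t : nat | X t w = s]].

(* The library's 'E_P[_] applies to real-valued functions only, and hitting
   times may be infinite. *)
Definition mean_hitting_time d (T : measurableType d) (R : realType)
    (P : probability T R) (X : nat -> {RV P >-> nat}) (s : nat) : \bar R :=
  (\int[P]_w hitting_time X s w)%E.

(* Main.v *)
(** Dynkin's formula for the potential [h a = p^-1 * \sum_(1 <= n < a) n^-1]: it
    vanishes at the target state 1, and one step of the chain from any other
    state decreases its mean by exactly 1. Let E_t be the mean of [h X_t] over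
    the event that 1 is not visited before time t, and let A_t be the
    probability that 1 is not visited up to time t. Then E_{t+1} = E_t - A_t, so
    the partial sums of the A_t are E_0 - E_t. They are bounded by E_0, so A_t
    tends to 0, and so does E_t, which is at most A_t times a constant. Hence
    the mean hitting time, which is the sum of all A_t, is E_0 = h i. *)

Require Import Defs.
From HB Require Import structures.
From mathcomp Require Import all_boot all_order all_algebra.
From mathcomp Require Import all_classical all_reals all_analysis.
From mathcomp Require Import measurable_realfun ring.

Set Implicit Arguments.
Unset Strict Implicit.
Unset Printing Implicit Defensive.

Import Order.TTheory GRing.Theory Num.Theory numFieldNormedType.Exports.

Local Open Scope classical_set_scope.
Local Open Scope ring_scope.

(** As the state space is bounded, a finite partition suffices, and probabilities are handled as
    real numbers through [fine]. *)
Lemma fine_measure_partition d (T : measurableType d) (R : realType)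
    (P : probability T R) (Y : {RV P >-> nat}) (n : nat) (E : set T) :
  measurable E -> (forall w, (Y w < n)%N) ->
  fine (P E) = \sum_(a < n) fine (P (E `&` [set w | Y w = a])).
Proof.
move=> mE Yn; pose F a := E `&` [set w | Y w = a].
have mF a : measurable (F a).
  by apply: measurableI => //; exact: (measurable_funPTI Y (Y := [set a])).
have -> : E = \big[setU/set0]_(a < n) F a.
  rewrite -bigcup_mkord; apply/seteqP; split=> [w Ew|w [a _ []]] //.
  by exists (Y w) => //=; exact: Yn.
rewrite measure_bigsetU//; last first.
  apply/trivIsetP => a b _ _ ab; rewrite -subset0 => w [[_ wa] [_ wb]].
  by rewrite -wa -wb eqxx in ab.
rewrite -sum_fine => [|a _]; last exact: fin_num_measure.
apply: eq_bigr => a _; congr (fine (P _)).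
rewrite -bigcup_mkord; apply/seteqP; split=> [w Faw|w [[b _ [Ew _]] wa]] //.
by split; [exists a => //=|case: Faw].
Qed.

(** * Markov property with a forgotten past *)

Section chain.
Context d (T : measurableType d) (R : realType) (P : probability T R).
Variables (S : set nat) (Q : nat -> nat -> R) (X : nat -> {RV P >-> nat}).
Hypothesis HX : markov_chain S Q X.
Variable n : nat.
Hypothesis Sn : forall a, S a -> (a < n)%N.

Lemma measurable_RV_pred t (G : set nat) : measurable [set w | G (X t w)].
Proof. exact: (measurable_funPTI (X t) (Y := G)). Qed.

Lemma measurable_RV_range (I : pred nat) (G : nat -> set nat) :
  measurable [set w | forall s, I s -> G s (X s w)].
Proof.
have -> : [set w | forall s, I s -> G s (X s w)] =
    \bigcap_(s in [set s | I s]) [set w | G s (X s w)] by [].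
by apply: bigcap_measurableType => s _; exact: measurable_RV_pred.
Qed.

(* Forgetting the exact values of the first j states, one at a time, leads from
   [history] (j = 0) to the event "in G before time t, at x t at time t"
   (j = t). *)
Definition past (G : set nat) (x : nat -> nat) (j t : nat) : set T :=
  [set w | (forall s, (s < j)%N -> G (X s w)) /\
           (forall s, (j <= s <= t)%N -> X s w = x s)].

Lemma measurable_past G x j t : measurable (past G x j t).
Proof.
apply: measurableI.
  exact: (measurable_RV_range (fun s => (s < j)%N) (fun=> G)).
exact: (measurable_RV_range (fun s => (j <= s <= t)%N) (fun s => [set x s])).
Qed.

(** Induction on [j]: splitting on the value of [X j] turns one more forgotten state into prescribed
    ones. The pieces all share the factor [Q (x t) b], so their equations add up. *)
Lemma markov_past G x j t b : S b -> (j <= t)%N ->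
  fine (P (past G x j t `&` [set w | X t.+1 w = b])) =
  Q (x t) b * fine (P (past G x j t)).
Proof.
move=> Sb; elim: j x => [|j IH] x jt.
  have -> : past G x 0 t = history X t x.
    by apply/seteqP; split=> [w []|w hw].
  have mh : measurable (history X t x).
    exact: (measurable_RV_range (fun s => (s <= t)%N) (fun s => [set x s])).
  (* The chain hypothesis says nothing about null histories; there both sides vanish. *)
  have [P0|] := eqVneq (P (history X t x)) 0%E.
    rewrite P0 mulr0; have := measure_ge0 P
      (history X t x `&` [set w | X t.+1 w = b]).
    suff : (P (history X t x `&` [set w | X t.+1 w = b]) <= 0)%E.
      by move=> ? ?; rewrite (_ : P _ = 0%E)//; apply/eqP; rewrite eq_le; apply/andP.
    rewrite -P0; apply: le_measure; rewrite ?inE //.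
    by apply: measurableI => //; exact: (measurable_RV_pred t.+1 [set b]).
  move=> P0; have Pp : (0 < P (history X t x))%E.
    by rewrite lt_neqAle eq_sym P0 measure_ge0.
  rewrite -(HX.2 t x b Sb Pp) /cond_prob setIC divfK//.
  by rewrite fine_eq0// fin_num_measure.
have Xn s w : (X s w < n)%N := Sn (HX.1 s w).
have mE := measurable_past G x j.+1 t.
rewrite (fine_measure_partition (Y := X j) (n := n))//; last first.
  by apply: measurableI => //; exact: (measurable_RV_pred t.+1 [set b]).
rewrite [in RHS](fine_measure_partition (Y := X j) (n := n))//.
rewrite mulr_sumr; apply: eq_bigr => v _.
have [Gv|Gv] := pselect (G v); last first.
  have E0 : past G x j.+1 t `&` [set w | X j w = v] = set0.
    rewrite -subset0 => w [[Gw _] wv]; apply: Gv; rewrite -wv.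
    exact: Gw.
  by rewrite setIAC E0 set0I measure0 mulr0.
(* Prescribing [v] at time [j] reduces to the induction hypothesis; [y t] is still [x t] because
   [j < t]. *)
pose y s := if s == j then v : nat else x s.
have yE : past G y j t = past G x j.+1 t `&` [set w | X j w = v].
  apply/seteqP; split=> [w [Gw xw]|w [[Gw xw] wv]].
    have wv : X j w = v by rewrite xw ?leqnn ?(ltnW jt)// /y eqxx.
    split=> //; split=> s.
      by rewrite ltnS leq_eqVlt => /predU1P[->|]; [rewrite wv|exact: Gw].
    move=> /andP[js st]; rewrite xw ?(ltnW js)// /y.
    by rewrite gtn_eqF.
  split=> s; first by move=> sj; apply: Gw; exact: ltnW.
  rewrite leq_eqVlt /y eq_sym => /andP[/predU1P[->|js] st]; first by rewrite eqxx.
  by rewrite gtn_eqF// xw// js.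
by rewrite setIAC -yE IH ?(ltnW jt)// /y gtn_eqF.
Qed.

(** * Hitting time as a sum of survival indicators *)

Lemma measurable_avoid s t : measurable [set w | forall r, (r <= t)%N -> X r w <> s].
Proof. exact: (measurable_RV_range (fun r => (r <= t)%N) (fun=> [set~ s])). Qed.

(** The indicator is 1 strictly before the first visit and 0 from then on, so the sum counts the
    steps before it. Without a visit, every term is 1 and both sides are infinite. *)
Lemma hitting_time_series s w :
  hitting_time X s w =
  (\sum_(0 <= t <oo) (\1_[set w | forall r, (r <= t)%N -> X r w <> s] w)%:E)%E.
Proof.
rewrite /hitting_time.
have [[t0 /eqP Xt0]|nhit] := pselect (exists t, X t w = s); last first.
  rewrite [X in ereal_inf X](_ : _ = set0) ?ereal_inf0; last first.
    by rewrite -subset0 => y [t Xt _]; apply: nhit; exists t.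
  apply/esym/eq_infty => r.
  (* This many terms, all equal to 1, already exceed [r]. *)
  apply: le_trans (nneseries_lim_ge (Num.truncn r).+1 _); last first.
    by move=> k _ _; rewrite lee_fin.
  under eq_bigr => k _.
    rewrite indicE mem_set => [|i _]; last by move=> Xi; apply: nhit; exists i.
    over.
  rewrite sumEFin lee_fin big_const_nat iter_addr addr0 subn0.
  exact/ltW/truncnS_gt.
have ex : exists t, X t w == s by exists t0.
have [k /eqP Xk kmin] := ex_minnP ex.
have -> : ereal_inf [set (t%:R%:E : \bar R) | t in [set t | X t w = s]] = k%:R%:E.
  apply/eqP; rewrite eq_le; apply/andP; split.
    by apply: ereal_inf_lbound; exists k.
  apply: le_ereal_inf_tmp => _ [t /= /eqP Xt <-].
  by rewrite lee_fin ler_nat kmin.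
rewrite (nneseries_split 0 k) => [|t _]; last by rewrite lee_fin.
rewrite add0n eseries0 => [|t kt _]; last first.
  by rewrite indicE memNset// => /(_ k kt).
rewrite adde0 big_mkord; under eq_bigr => t _.
  rewrite indicE mem_set => [|r rt /eqP /kmin]; last first.
    by rewrite leqNgt (leq_ltn_trans rt (ltn_ord t)).
  over.
by rewrite sumEFin big_const_ord iter_addr addr0.
Qed.

Lemma mean_hitting_time_series s :
  mean_hitting_time X s =
  (\sum_(0 <= t <oo) P [set w | forall r, (r <= t)%N -> X r w <> s])%E.
Proof.
rewrite /mean_hitting_time; under eq_integral => w _ do rewrite hitting_time_series.
rewrite integral_nneseries//; last first.
  by move=> t; apply/measurable_EFinP; exact/measurable_indic/measurable_avoid.
apply: eq_eseriesr => t _.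
by rewrite integral_indic ?setIT//; exact: measurable_avoid.
Qed.

(** * The chain killed at the target *)

Definition first_at s t a := past [set~ s] (fun=> a) t t.

(** The path in [first_at] can be constant since it is read at time [t] only. For [a = s] the event
    is a first visit to [s] at time [t]; for other [a] it is survival up to [t], ending in [a]. *)
Lemma first_atE s t a :
  first_at s t a = [set w | (forall r, (r < t)%N -> X r w <> s) /\ X t w = a].
Proof.
apply/seteqP; split=> w [Aw Xw]; split=> //; first by apply: Xw; rewrite leqnn.
by move=> r; rewrite -eqn_leq => /eqP <-.
Qed.

Lemma first_at_notin s t a : ~ S a -> first_at s t a = set0.
Proof.
move=> Sa; rewrite first_atE -subset0 => w [_ wa]; apply: Sa; rewrite -wa.
exact: HX.1.
Qed.

Lemma chain_lt t w : (X t w < n)%N.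
Proof. by apply: Sn; exact: HX.1. Qed.

(** Paths that are in [s] at time [t] are excluded, hence [a != s]; on the others [markov_past]
    applies with the complement of [s] as [G]. *)
Lemma first_atS s t b : S b ->
  fine (P (first_at s t.+1 b)) =
  \sum_(a < n | a != s :> nat) Q a b * fine (P (first_at s t a)).
Proof.
move=> Sb; rewrite (fine_measure_partition (Y := X t) (n := n)); last 2 first.
- exact: measurable_past.
- exact: chain_lt.
rewrite [RHS]big_mkcond; apply: eq_bigr => a _; case: eqVneq => [a_s|a_s] /=.
  rewrite (_ : _ `&` _ = set0) ?measure0// -subset0 => w [].
  by rewrite first_atE => -[/(_ t (ltnSn t)) + _] wa; rewrite wa a_s.
rewrite -(markov_past [set~ s] (fun=> a : nat))//; congr (fine (P _)).
rewrite -/(first_at _ _ _) !first_atE.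
apply/seteqP; split=> [w [[Aw wb] wa]|w [[Aw wa] wb]].
  by split=> //; split=> // r rt; apply: Aw; exact: ltnW.
split=> //; split=> // r; rewrite ltnS leq_eqVlt => /predU1P[->|]; last exact: Aw.
by rewrite wa; exact/eqP.
Qed.

Lemma avoid_first_at s t :
  fine (P [set w | forall r, (r <= t)%N -> X r w <> s]) =
  \sum_(a < n | a != s :> nat) fine (P (first_at s t a)).
Proof.
rewrite (fine_measure_partition (Y := X t) (n := n)); last 2 first.
- exact: measurable_avoid.
- exact: chain_lt.
rewrite [RHS]big_mkcond; apply: eq_bigr => a _; case: eqVneq => [a_s|a_s] /=.
  rewrite (_ : _ `&` _ = set0) ?measure0// -subset0 => w [/(_ t (leqnn t))] + wa.
  by rewrite wa a_s.
rewrite first_atE; congr (fine (P _)).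
apply/seteqP; split=> [w [Aw wa]|w [Aw wa]]; split=> // r.
  by move=> /ltnW; exact: Aw.
rewrite leq_eqVlt => /predU1P[->|]; last exact: Aw.
by rewrite wa; exact/eqP.
Qed.

(** * Dynkin's formula and its limit *)

Variables (s : nat) (h : nat -> R).
Hypothesis h_ge0 : forall a, 0 <= h a.
Hypothesis h_target : h s = 0.
Hypothesis h_step : forall a, S a -> a != s ->
  \sum_(b < n | (b : nat) \in S) Q a b * h b = h a - 1.

(** [alive] and [energy] are A_t and E_t. The sum in [energy] may include the target, as
    [h s = 0]. *)
Let alive t := fine (P [set w | forall r, (r <= t)%N -> X r w <> s]).
Let energy t := \sum_(a < n) fine (P (first_at s t a)) * h a.

Lemma energyE t :
  energy t = \sum_(a < n | a != s :> nat) fine (P (first_at s t a)) * h a.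
Proof.
rewrite /energy (bigID (fun a : 'I_n => a != s :> nat))/= addrC big1 ?add0r// => a.
by move=> /negPn/eqP ->; rewrite h_target mulr0.
Qed.

(** After expanding by [first_atS] and exchanging the sums, [h_step] applies to each surviving state
    [a], and the subtracted 1's add up to [alive t]. *)
Lemma energyS t : energy t.+1 = energy t - alive t.
Proof.
have -> : energy t.+1 = \sum_(b < n | (b : nat) \in S)
    \sum_(a < n | a != s :> nat) fine (P (first_at s t a)) * (Q a b * h b).
  rewrite /energy [RHS]big_mkcond; apply: eq_bigr => b _; case: ifPn => Sb.
    rewrite (first_atS _ _ (set_mem Sb)) mulr_suml; apply: eq_bigr => a _.
    by rewrite mulrCA mulrA.
  by rewrite first_at_notin ?measure0 ?mul0r//; move/mem_set; exact/negP.
rewrite exchange_big/= /alive avoid_first_at energyE.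
rewrite -sumrB; apply: eq_bigr => a a_s; rewrite -mulr_sumr.
have [Sa|Sa] := pselect (S a); first by rewrite h_step// mulrBr mulr1.
by rewrite first_at_notin// measure0 !mul0r subrr.
Qed.

Lemma sum_alive t : \sum_(0 <= r < t) alive r = energy 0%N - energy t.
Proof.
elim: t => [|t IH]; first by rewrite big_nil subrr.
by rewrite big_nat_recr//= IH energyS opprB addrA addrAC.
Qed.

Lemma energy_ge0 t : 0 <= energy t.
Proof. by apply: sumr_ge0 => a _; rewrite mulr_ge0// fine_ge0. Qed.

Lemma alive_ge0 t : 0 <= alive t.
Proof. exact: fine_ge0. Qed.

Lemma energy_le t : energy t <= alive t * \sum_(a < n) h a.
Proof.
rewrite /alive avoid_first_at energyE mulr_suml.
apply: ler_sum => a _; rewrite ler_wpM2l ?fine_ge0//.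
by rewrite (bigD1 a)//= lerDl sumr_ge0.
Qed.

Lemma series_alive_cvg : (series alive : nat -> R) @ \oo --> energy 0%N.
Proof.
have serE : series alive = (fun t => energy 0%N - energy t).
  by apply/funext => t; rewrite /series/= sum_alive.
have alive0 : alive @ \oo --> (0 : R).
  apply: cvg_series_cvg_0; apply: nondecreasing_is_cvgn.
    by apply/nondecreasing_seqP => t; rewrite !seriesEnat/= big_nat_recr//= lerDl alive_ge0.
  by exists (energy 0%N) => _ [t _ <-]; rewrite serE gerBl energy_ge0.
rewrite serE -[X in _ --> X]subr0; apply: cvgB; first exact: cvg_cst.
apply: (@squeeze_cvgr _ _ _ _ (fun=> 0) (fun t => alive t * \sum_(a < n) h a)).
- by apply: nearW => t; rewrite energy_ge0 energy_le.
- exact: cvg_cst.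
- by rewrite -[X in _ --> X](mul0r (\sum_(a < n) h a)); exact: cvgMl.
Qed.

Lemma mean_hitting_time_potential i : S i -> P [set w | X 0%N w = i] = 1%E ->
  mean_hitting_time X s = (h i)%:E.
Proof.
move=> Si Pi; rewrite mean_hitting_time_series.
have -> : h i = energy 0%N.
  have E0 a : first_at s 0 a = [set w | X 0%N w = a].
    by rewrite first_atE; apply/seteqP; split=> [w []|w].
  rewrite /energy (bigD1 (Ordinal (Sn Si)))//= E0 Pi mul1r big1 ?addr0// => a ai.
  (* The chain starts in [i] only almost surely: any other start lies in the complement of an event
     of probability 1. *)
  have -> : P (first_at s 0 a) = 0%E; last by rewrite mul0r.
  apply/eqP; rewrite eq_le measure_ge0 andbT.
  rewrite -(subee (x := 1%E))// -[X in (_ <= _ - X)%E]Pi.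
  rewrite -probability_setC; last exact: (measurable_RV_pred 0 [set i]).
  apply: le_measure; rewrite ?inE.
  - exact: measurable_past.
  - by apply: measurableC; exact: (measurable_RV_pred 0 [set i]).
  - by rewrite E0 => w /= ->; exact/eqP.
rewrite (eq_eseriesr (g := fun t => (alive t)%:E)); last first.
  by move=> t _; rewrite fineK// fin_num_measure//; exact: measurable_avoid.
apply: cvg_lim => //; rewrite (_ : (fun t => _) = EFin \o series alive).
  by apply: cvg_EFin; [exact: nearW | exact: series_alive_cvg].
by apply/funext => t /=; rewrite sumEFin.
Qed.

End chain.

(** * Drift of the descent chain and the harmonic sum *)

Lemma descent_potential_step (R : realType) (p : R) (m a : nat) (h : nat -> R) :
  (1 < a <= m)%N -> a.-1%:R * p * (h a - h a.-1) = 1 ->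
  \sum_(b < m.+1 | (b : nat) \in [set a | (1 <= a <= m)%N])
    descent_trans p a b * h b = h a - 1.
Proof.
case: a => // a /andP[a0 am] /= ha.
rewrite big_mkcond/=.
under eq_bigr => b _.
  (* The state is now [a.+1], with possible targets [a] and [a.+1]; [a0] ensures that the lower one
     is still in the state space. *)
  rewrite (_ : (if _ then _ else _) =
      (if (b == a :> nat) then a%:R * p * h a else 0) +
      (if (b == a.+1 :> nat) then (1 - a%:R * p) * h a.+1 else 0)); last first.
    rewrite /descent_trans eqSS [a == b]eq_sym [a.+1 == b]eq_sym.
    have [-> /=|ba] := eqVneq (b : nat) a.
      by rewrite [a == a.+1]ltn_eqF// addr0 mem_set//= -ltnS a0 ltnW.
    have [-> /=|ba'] := eqVneq (b : nat) a.+1.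
      by rewrite mem_set//= add0r.
    by rewrite mul0r add0r if_same.
  over.
rewrite big_split/= -2!big_mkcond.
rewrite (big_ord1_eq _ (fun=> a%:R * p * h a)) (big_ord1_eq _ (fun=> _ * h a.+1)).
rewrite ltnS (ltnW am) ltnS am.
(* The mean drop is [a%:R * p * (h a.+1 - h a)], which [ha] sets to 1. *)
by rewrite -[X in _ = _ - X]ha; ring.
Qed.

(** By induction it suffices that 1/(n+2) is at most ln((n+2)/(n+1)), which is ln(1+x) <= x at x =
    -1/(n+2). *)
Lemma harmonic_sum_le_ln (R : realType) (n : nat) : (0 < n)%N ->
  \sum_(1 <= k < n.+1) k%:R^-1 <= 1 + ln n%:R :> R.
Proof.
elim: n => // -[_ _|n IH _]; first by rewrite big_nat1 invr1 ln1 addr0.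
rewrite big_nat_recr//=; apply: le_trans (lerD (IH isT) (lexx _)) _.
rewrite -addrA lerD2l -lerBrDl -ln_div ?posrE ?ltr0n//.
rewrite -[X in _ <= X]opprK -lnV ?posrE ?divr_gt0 ?ltr0n// invf_div lerNr.
have -> : n.+1%:R / n.+2%:R = 1 + - n.+2%:R^-1 :> R.
  by rewrite -[n.+1%:R](addrK 1) natr1 mulrBl divff ?pnatr_eq0// div1r.
by apply: le_ln1Dx; rewrite ltrN2 invf_lt1 ?ltr0n// ltr1n.
Qed.

Theorem mainTheorem3 (R : realType) (m N : nat) (p : R)
    (d : measure_display) (T : measurableType d) (P : probability T R)
    (hm : (2 <= m)%N) (hN : (m <= N)%N) (hp : 0 < N%:R * p < 1) :
  (forall (i : nat) (X : nat -> {RV P >-> nat}),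
     (1 <= i <= m)%N ->
     markov_chain [set a | (1 <= a <= m)%N] (descent_trans p) X ->
     P [set w | X 0%N w = i] = 1%E ->
     mean_hitting_time X 1%N = (p^-1 * \sum_(1 <= n < i) n%:R^-1)%:E)
  /\
  (forall X : nat -> {RV P >-> nat},
     markov_chain [set a | (1 <= a <= m)%N] (descent_trans p) X ->
     P [set w | X 0%N w = m] = 1%E ->
     mean_hitting_time X 1%N = (p^-1 * \sum_(1 <= n < m) n%:R^-1)%:E)
  /\
  p^-1 * \sum_(1 <= n < m) n%:R^-1 <= (1 + ln (m%:R - 1)) / p.
Proof.
have p0 : 0 < p.
  have N0 : (0 < N)%N := leq_trans (ltnW hm) hN.
  by move: hp => /andP[+ _]; rewrite pmulr_rgt0// ltr0n.
have mean i (X : nat -> {RV P >-> nat}) : (1 <= i <= m)%N ->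
    markov_chain [set a | (1 <= a <= m)%N] (descent_trans p) X ->
    P [set w | X 0%N w = i] = 1%E ->
    mean_hitting_time X 1%N = (p^-1 * \sum_(1 <= n < i) n%:R^-1)%:E.
  move=> im HX Pi; pose h a : R := p^-1 * \sum_(1 <= n < a) n%:R^-1.
  apply: (mean_hitting_time_potential HX (n := m.+1) _ (h := h)) => //.
  - by move=> a /andP[].
  - by move=> a; rewrite mulr_ge0 ?invr_ge0 ?(ltW p0)// sumr_ge0.
  - by rewrite /h big_geq// mulr0.
  - move=> a /= /andP[a1 am] an1; have a2 : (1 < a)%N by rewrite ltn_neqAle eq_sym an1.
    apply: descent_potential_step; first by rewrite a2.
    case: a a2 {an1 a1 am} => // -[//|a] _ /=.
    (* Consecutive potentials differ by the last term 1/((a+1)p), the inverse of the probability of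
       moving down from [a.+2]. *)
    rewrite /h (big_nat_recr a.+1)//= -mulrBr addrAC subrr add0r.
    by field; rewrite nat1r pnatr_eq0 (gt_eqF p0).
split=> //; split; first by move=> X; apply: mean; rewrite leqnn ltnW.
rewrite mulrC ler_pM2r ?invr_gt0//.
case: m hm {hN mean} => // m m1; rewrite -natr1 addrK.
exact: harmonic_sum_le_ln.
Qed.
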